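(* Any $\sigma(\mathcal{P},C_b)$-lower semicontinuous risk measure $\Phi:\mathcal{P}(\mathbb{R})\to\mathbb{R}\cup\{+\infty\}$ can be represented as $$\Phi(P)=\sup_{Q\in\mathcal{P}_c(\mathbb{R})}R\left(-\int F_Q\,dP,\,-F_Q\right),\qquad P\in\mathcal{P}(\mathbb{R}),$$ where $\mathcal{P}_c(\mathbb{R})=\{Q\in\mathcal{P}(\mathbb{R})\mid F_Q\text{ is continuous}\}$ and $R:\mathbb{R}\times C_b\to\overline{\mathbb{R}}$ is defined by $R(t,f):=\inf_{Q\in\mathcal{P}}\left\{\Phi(Q)\mid\int f\,dQ\ge t\right\}$.
   Context: $\mathcal{P}=\mathcal{P}(\mathbb{R})$ is the set of Borel probability measures on $\mathbb{R}$, $F_P(x)=P(-\infty,x]$, and $Q\preccurlyeq P$ iff $F_P(x)\le F_Q(x)$ for all $x\in\mathbb{R}$. $C_b$ is the space of bounded continuous functions $f:\mathbb{R}\to\mathbb{R}$; $\sigma(\mathcal{P},C_b)$ is the topology of weak convergence. A risk measure on $\mathcal{P}(\mathbb{R})$ is a map $\Phi:\mathcal{P}\to\mathbb{R}\cup\{+\infty\}$ that is monotone decreasing ($P\preccurlyeq Q$ implies $\Phi(P)\ge\Phi(Q)$) and quasi-convex ($\Phi(\lambda P+(1-\lambda)Q)\le\Phi(P)\vee\Phi(Q)$ for $\lambda\in[0,1]$). Convention: $\inf\emptyset=+\infty$. *)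

(* Defs.v *)
From HB Require Import structures.
From mathcomp Require Import all_boot all_order all_algebra.
From mathcomp Require Import all_classical all_reals all_analysis.

Set Implicit Arguments.
Unset Strict Implicit.
Unset Printing Implicit Defensive.

Import Order.TTheory GRing.Theory Num.Theory.
Import numFieldNormedType.Exports.

Local Open Scope classical_set_scope.
Local Open Scope ring_scope.

Notation Prob R := (probability (measurableTypeR R) R).

Definition cdf_of (R : realType) (P : Prob R) (x : R) : R :=
  fine (P `]-oo, x]%classic).

Definition sto_le (R : realType) (Q P : Prob R) : Prop :=
  forall x : R, cdf_of P x <= cdf_of Q x.

Record Cb (R : realType) := MkCb {
  Cb_fun :> R -> R ;
  Cb_continuous : continuous Cb_fun ;
  Cb_bounded : bounded_fun Cb_fun }.

HB.instance Definition _ (R : realType) := gen_eqMixin (Cb R).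
HB.instance Definition _ (R : realType) := gen_choiceMixin (Cb R).

(* The initial topology for the map P |-> (\int f dP)_f into the product
   of copies of R indexed by Cb R, i.e., the coarsest topology making every
   P |-> \int f dP with f in Cb R continuous. *)
Definition weak_Prob (R : realType) : topologicalType :=
  initial_topology
    (fun P : Prob R =>
       (fun f : Cb R => (\int[P]_x f x)%R) : {ptws (Cb R) -> R}).

Section mixture.
Context (R : realType).
Variables (l : {i01 R}) (P Q : Prob R).

Definition mixture : set (measurableTypeR R) -> \bar R :=
  measure_add (mscale l%:num%:nng P) (mscale (1 - l%:num)%:nng Q).

HB.instance Definition _ := Measure.on mixture.

Lemma mixtureE (A : set (measurableTypeR R)) :
  mixture A = (l%:num%:E * P A + (1 - l%:num)%:E * Q A)%E.
Proof. by rewrite /mixture measure_addE. Qed.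

Let mixtureT : mixture setT = 1%E.
Proof.
by rewrite mixtureE !probability_setT !mule1 -EFinD addrCA subrr addr0.
Qed.

HB.instance Definition _ :=
  Measure_isProbability.Build _ _ _ mixture mixtureT.

End mixture.

Definition monotone_decreasing (R : realType) (Phi : Prob R -> \bar R) : Prop :=
  forall P Q : Prob R, sto_le P Q -> (Phi Q <= Phi P)%E.

Definition quasi_convex (R : realType) (Phi : Prob R -> \bar R) : Prop :=
  forall (l : {i01 R}) (P Q : Prob R),
    (Phi (mixture l P Q : Prob R) <= maxe (Phi P) (Phi Q))%E.

Definition risk_measure (R : realType) (Phi : Prob R -> \bar R) : Prop :=
  [/\ forall P, Phi P != -oo%E, monotone_decreasing Phi & quasi_convex Phi].

Definition Prob_c (R : realType) : set (Prob R) :=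
  [set Q | continuous (cdf_of Q)].

Section opp_cdf.
Context (R : realType).
Variable Q : @Prob_c R.

Lemma opp_cdf_continuous : continuous (fun x : R => - cdf_of (\val Q) x).
Proof. by move=> x; apply: cvgN; exact: (set_valP Q). Qed.

Lemma opp_cdf_bounded : bounded_fun (fun x : R => - cdf_of (\val Q) x).
Proof.
exists 1; split => // M M1 x _ /=.
rewrite normrN ger0_norm ?fine_ge0//; apply: (le_trans _ (ltW M1)).
by rewrite -lee_fin fineK ?fin_num_measure//; exact: probability_le1.
Qed.

Definition opp_cdf : Cb R := MkCb opp_cdf_continuous opp_cdf_bounded.

End opp_cdf.

(* The infimum over the empty set is +oo. *)
Definition dual_fun (R : realType) (Phi : Prob R -> \bar R)
    (t : R) (f : Cb R) : \bar R :=
  ereal_inf [set Phi Q | Q in [set Q : Prob R | t <= (\int[Q]_x f x)%R]].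

(* Main.v *)
Require Import Defs.
From HB Require Import structures.
From mathcomp Require Import all_boot all_order all_algebra.
From mathcomp Require Import all_classical all_reals all_analysis.
From mathcomp Require Import measurable_realfun.
From mathcomp Require Import ring lra.

Set Implicit Arguments.
Unset Strict Implicit.
Unset Printing Implicit Defensive.

Import Order.TTheory GRing.Theory Num.Theory.
Import numFieldNormedType.Exports.

Local Open Scope classical_set_scope.
Local Open Scope ring_scope.

(** For a real [a < Phi P], the set [A] of the laws [Q] with [Phi Q <= a] is
    convex, closed upwards for the stochastic order, and misses a weak
    neighbourhood of [P], which is given by finitely many functions of [Cb].
    Separating in finite dimension yields a bounded continuous [f] with
    [\int f dP + d <= \int f dQ] on [A]. Replacing [f x] by the infimum of [f]
    over [x, +oo[ can only decrease the left-hand side, and it preserves the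
    inequality because [A] is closed upwards. The new function is nondecreasing, hence an
    affine image of a continuous cdf [F], and then no [Q] with
    [\int F dQ <= \int F dP] lies in [A]. *)

(** * Weak neighbourhoods and separation in finite dimension *)

(** The sets [near_on] generate a filter [G]. Convergence of [T] along [G] to [T P] in the product
    topology is tested coordinatewise, where one-element lists suffice; hence [G] contains every
    weak neighbourhood of [P]. *)
Lemma weak_nbhs_finite (R : realType) (P : Prob R) (V : set (Prob R)) :
  nbhs (P : weak_Prob R) V ->
  exists (s : seq (Cb R)) (e : R), 0 < e /\
    forall Q : Prob R,
      (forall f, f \in s -> `|\int[Q]_x f x - \int[P]_x f x| < e) -> V Q.
Proof.
pose near_on (p : seq (Cb R) * R) : set (Prob R) := [set Q : Prob R |
  forall f, f \in p.1 -> `|\int[Q]_x f x - \int[P]_x f x| < p.2].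
pose G := filter_from [set p : seq (Cb R) * R | 0 < p.2] near_on.
have FG : Filter G.
  apply: filter_from_filter; first by exists ([::], 1) => /=.
  move=> [s a] [t b] /= a0 b0; exists (s ++ t, Num.min a b) => /=.
    by rewrite lt_min a0.
  move=> Q /= sQ; split=> f /= fs.
    have := sQ f; rewrite mem_cat fs => /(_ isT).
    by move=> h; apply: (lt_le_trans h); rewrite ge_min lexx.
  have := sQ f; rewrite mem_cat fs orbT => /(_ isT).
  by move=> h; apply: (lt_le_trans h); rewrite ge_min lexx orbT.
pose T := fun Q : Prob R =>
  (fun f : Cb R => (\int[Q]_x f x)%R) : {ptws (Cb R) -> R}.
have TG : T @ G --> T P.
  apply/cvg_sup => f A; rewrite nbhsE => -[_ [[B oB <-] /= BP]] BA.
  have /nbhs_ballP[e /= e0 eB] : nbhs (T P f) B by exact: open_nbhs_nbhs.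
  exists ([:: f], e) => // Q /=.
  move=> /(_ f); rewrite mem_head distrC => /(_ isT) fe.
  by apply: BA; exact: eB.
rewrite nbhsE => -[B [[C oC <-] /= CP]] BV.
have [[s e] /= e0 sC] : G (T @^-1` C) by apply: TG; exact: open_nbhs_nbhs.
by exists s, e; split => // Q sQ; apply: BV; exact: sC.
Qed.

(* A near-minimizer [v0] of the norm over [C] separates [C] from 0. *)
Lemma convex_separation (R : realType) (I : finType) (C : set (I -> R))
    (e M : R) :
  0 < e ->
  (forall v i, C v -> `|v i| <= M) ->
  (forall v, C v -> exists i, e <= `|v i|) ->
  (forall (t : R) v w, 0 <= t <= 1 -> C v -> C w ->
     C (fun i => t * v i + (1 - t) * w i)) ->
  exists (c : I -> R) (d : R), 0 < d /\
    forall v, C v -> d <= \sum_i c i * v i.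
Proof.
move=> e0 CM Ce Ccvx.
have [[v1 Cv1]|C0] := pselect (C !=set0); last first.
  by exists (fun=> 0), 1; split => // v Cv; case: C0; exists v.
pose N (v : I -> R) := \sum_i v i ^+ 2.
pose d := inf (N @` C).
have Nlb v : C v -> e ^+ 2 <= N v.
  move=> Cv; have [i ei] := Ce v Cv.
  rewrite /N (bigD1 i)//= -[X in X <= _]addr0 lerD ?sumr_ge0//.
    by rewrite -[leRHS]real_normK ?num_real// ler_sqr ?nnegrE// ltW.
  by move=> j _; rewrite sqr_ge0.
have lbN : lbound (N @` C) (e ^+ 2) by move=> _ [v Cv <-]; exact: Nlb.
have hasinf : has_inf (N @` C).
  by split; [exists (N v1), v1|exists (e ^+ 2)].
have d0 : 0 < d.
  apply: (@lt_le_trans _ _ (e ^+ 2)); first by rewrite exprn_gt0.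
  by apply: lb_le_inf => //; case: hasinf.
(* [B] bounds the squared distances between points of [C]. The summand [d] makes it positive and
   keeps the step length [s] below 1. *)
pose B := \sum_(i : I) (2 * M) ^+ 2 + d.
have B0 : 0 < B by rewrite ltr_wpDl// sumr_ge0// => i _; rewrite sqr_ge0.
have dB : d <= B by rewrite lerDr sumr_ge0// => i _; rewrite sqr_ge0.
pose s := d / (2 * B).
have s0 : 0 < s by rewrite divr_gt0// mulr_gt0.
have s1 : s <= 1 by rewrite ler_pdivrMr ?mulr_gt0//; lra.
have sB : s * B = d / 2 by rewrite /s; field; rewrite gt_eqF.
have [|_ [v0 Cv0 <-] Nv0] := @inf_adherent _ (N @` C) (s * d / 2) _ hasinf.
  by rewrite divr_gt0// mulr_gt0.
exists v0, (d / 2); split; first by rewrite divr_gt0.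
move=> v Cv; rewrite -/d in Nv0.
have NB : \sum_i (v i - v0 i) ^+ 2 <= B.
  rewrite /B -[X in X <= _]addr0 lerD ?(ltW d0)//; apply: ler_sum => i _.
  rewrite -[leLHS]real_normK ?num_real// ler_sqr ?nnegrE//; last first.
    by rewrite mulr_ge0// (le_trans _ (CM v i Cv)).
  by rewrite (le_trans (ler_normB _ _))// mulr_natl mulr2n lerD ?CM.
have Cs : C (fun i => s * v i + (1 - s) * v0 i).
  by apply: Ccvx; rewrite ?s1 ?(ltW s0).
have dN : d <= N (fun i => s * v i + (1 - s) * v0 i).
  by apply: ge_inf; [exists (e ^+ 2)|eexists; first exact: Cs].
(* Expansion of the squared norm on the segment from [v0] to [v]. Its value is at least [d], while
   [N v0 - d] and the quadratic term are each at most [s * d / 2]. Dividing by [2 * s] leaves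
   [\sum_i v0 i * v i >= N v0 - d / 2 >= d / 2]. *)
have NE : N (fun i => s * v i + (1 - s) * v0 i) =
    N v0 + 2 * s * (\sum_i v0 i * v i - N v0) + s ^+ 2 * \sum_i (v i - v0 i) ^+ 2.
  rewrite /N -sumrB !mulr_sumr -!big_split/=; apply: eq_bigr => i _; ring.
have dN0 : d <= N v0 by apply: ge_inf; [exists (e ^+ 2)|exists v0].
set x := \sum_i v0 i * v i in NE *.
have : s * (\sum_i (v i - v0 i) ^+ 2) <= d / 2.
  by rewrite -sB ler_pM2l.
set y := \sum_i (v i - v0 i) ^+ 2 in NB NE *.
rewrite -(ler_pM2l s0) mulrA -expr2 => sy.
rewrite -(ler_pM2l s0); rewrite NE in dN.
set n := N v0 in dN0 Nv0 dN.
have : s * d <= s * n by rewrite ler_pM2l.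
lra.
Qed.

(** * Integrals of bounded functions against probability measures *)

Section prob_integral.
Context {R : realType}.
Implicit Types (P Q : Prob R) (f g : R -> R).

Lemma bounded_prob_integrable P f (M : R) :
  measurable_fun (setT : set (measurableTypeR R)) f ->
  (forall x, `|f x| <= M) -> P.-integrable setT (EFin \o f).
Proof.
move=> mf fM; apply: measurable_bounded_integrable => //.
  by apply: (@le_lt_trans _ _ 1%E); [exact: probability_le1|rewrite ltry].
exists M; split => [|N MN x _]; first by rewrite num_real.
by apply: (le_trans (fM x)); exact: ltW.
Qed.

Lemma mixture_Rintegral (l : {i01 R}) P Q f (M : R) :
  measurable_fun (setT : set (measurableTypeR R)) f ->
  (forall x, `|f x| <= M) ->
  \int[mixture l P Q]_x f x =
  l%:num * \int[P]_x f x + (1 - l%:num) * \int[Q]_x f x.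
Proof.
move=> mf fM.
have intf (S : Prob R) : S.-integrable setT (EFin \o f) :=
  bounded_prob_integrable S mf fM.
(* Additivity in the measure is applied to nonnegative integrands, hence the shift by [M]; against a
   probability it adds exactly [M]. *)
have shift (S : Prob R) : (\int[S]_x (f x + M)%:E)%E = (\int[S]_x f x + M)%:E.
  under eq_integral do rewrite EFinD.
  rewrite integralD//=; last first.
    by apply: (@bounded_prob_integrable S (fun=> M) `|M|).
  have /fineK <- : (\int[S]_x (f x)%:E)%E \is a fin_num.
    exact: (integrable_fin_num _ (intf S)).
  by rewrite integral_cst//= probability_setT mule1.
have fM0 x : (0 <= (f x + M)%:E)%E.
  by rewrite lee_fin; have := fM x; rewrite ler_norml; lra.
have mfM := measurable_funD mf (measurable_cst M).
have : (\int[mixture l P Q]_x (f x + M)%:E)%E =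
    (l%:num%:E * \int[P]_x (f x + M)%:E
     + (1 - l%:num)%:E * \int[Q]_x (f x + M)%:E)%E.
  rewrite [LHS](_ : _ = \int[measure_add (mscale (l%:num%:nng)%R P)
     (mscale ((1 - l%:num)%:nng)%R Q)]_x (f x + M)%:E)%E//.
  by rewrite ge0_integral_measure_add ?ge0_integral_mscale//;
    apply/measurable_EFinP.
rewrite !shift -!EFinM -EFinD => -[] h.
by apply: (addIr M); rewrite h; ring.
Qed.

Lemma continuous_measurable_prob f : continuous f ->
  measurable_fun (setT : set (measurableTypeR R)) f.
Proof. exact: continuous_measurable_fun. Qed.

Lemma Rintegral_sum_prob P (I : Type) (r : seq I) (F : I -> R -> R) (M : I -> R) :
  (forall i, measurable_fun (setT : set (measurableTypeR R)) (F i)) ->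
  (forall i x, `|F i x| <= M i) ->
  \int[P]_x (\sum_(i <- r) F i x) = \sum_(i <- r) \int[P]_x F i x.
Proof.
move=> mF FM; elim: r => [|i r IH].
  under eq_Rintegral do rewrite big_nil.
  by rewrite big_nil Rintegral_cst// mul0r.
under eq_Rintegral do rewrite big_cons.
rewrite big_cons RintegralD//; first by rewrite IH.
  exact: (bounded_prob_integrable P (mF i) (FM i)).
apply: (@bounded_prob_integrable _ _ (\sum_(i <- r) M i)).
  exact: measurable_sum.
by move=> x; rewrite (le_trans (ler_norm_sum _ _ _))// ler_sum.
Qed.

Lemma Cb_bound (f : Cb R) : exists M, forall x, `|f x| <= M.
Proof.
have [M [_ fM]] := Cb_bounded f; exists (M + 1) => x.
by apply: fM => //; rewrite ltrDl.
Qed.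

End prob_integral.

(** * The running infimum and its integrals *)

(** For bounded [f], this is the largest nondecreasing function below [f]. *)
Definition running_inf (R : realType) (f : R -> R) (x : R) : R :=
  inf [set f y | y in [set y | x <= y]].

Section running_inf.
Context {R : realType}.
Variables (f : R -> R) (M : R).
Hypotheses (fM : forall x, `|f x| <= M) (fc : continuous f).

Let has_inf_tail x : has_inf [set f y | y in [set y | x <= y]].
Proof.
split; first by exists (f x), x => /=.
by exists (- M) => _ [y _ <-]; have := fM y; rewrite ler_norml => /andP[].
Qed.

Lemma running_inf_le x y : x <= y -> running_inf f x <= f y.
Proof. by move=> xy; apply: ge_inf; [case: (has_inf_tail x)|exists y]. Qed.

Lemma running_inf_ge x a : (forall y, x <= y -> a <= f y) -> a <= running_inf f x.
Proof.
move=> h; apply: lb_le_inf; first by case: (has_inf_tail x).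
by move=> _ [y xy <-]; exact: h.
Qed.

Lemma running_inf_nondecreasing : {homo running_inf f : x y / x <= y}.
Proof.
move=> x y xy; apply: running_inf_ge => z yz.
by apply: running_inf_le; exact: le_trans yz.
Qed.

Lemma running_inf_bound x : `|running_inf f x| <= M.
Proof.
rewrite ler_norml; apply/andP; split.
  by apply: running_inf_ge => y _; have := fM y; rewrite ler_norml => /andP[].
rewrite (le_trans (running_inf_le (lexx x)))//.
by have := fM x; rewrite ler_norml => /andP[].
Qed.

(** Passing from [u] to a larger [v] near [x] only discards values of [f] on [[u, v[]. These are at
    least [f v - e], so the infimum rises by at most [e]. *)
Lemma running_inf_continuous : continuous (running_inf f).
Proof.
move=> x; apply/cvgrPdist_le => e e0.
have /nbhs_ballP[d /= d0 fd] : \forall y \near x, `|f x - f y| <= e / 2.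
  by have /cvgrPdist_le := @fc x; apply; rewrite divr_gt0.
have osc u v : ball x d u -> ball x d v -> u <= v ->
    `|running_inf f v - running_inf f u| <= e.
  move=> xu xv uv.
  rewrite ger0_norm ?subr_ge0 ?running_inf_nondecreasing// lerBlDr addrC -lerBlDr.
  apply: running_inf_ge => y uy; have [vy|yv] := leP v y.
    by have := running_inf_le vy; lra.
  have xy : ball x d y.
    move: xu xv; rewrite /ball/= !ltr_norml; lra.
  have := running_inf_le (lexx v).
  have := fd _ xv; have := fd _ xy; rewrite !ler_norml/=; lra.
apply/nbhs_ballP; exists d => //= y xy.
have xx : ball x d x by exact: ballxx.
by have [|/ltW] := leP y x => ?; [|rewrite distrC]; exact: osc.
Qed.

(** An enumeration of the nonnegative rationals, with 0 for the codes of no rational. Countably many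
    shifts keep the selection below measurable, and their density suffices because [f] is
    continuous. *)
Let q (n : nat) : R := `|ratr (odflt 0 (unpickle n : option rat))|.

(* Along [selector n], a measurable map above the identity, [Q] is pushed forward
   to a law that dominates [Q], and [f \o selector n] decreases to
   [running_inf f]. *)
Let selector := fix selector (n : nat) (x : R) : R :=
  if n is m.+1 then
    if f (x + q m) < f (selector m x) then x + q m else selector m x
  else x.

Let selector_ge n x : x <= selector n x.
Proof.
elim: n => //= n IH; case: ifP => // _.
by rewrite lerDl normr_ge0.
Qed.

Let selector_min n x k : (k < n)%N -> f (selector n x) <= f (x + q k).
Proof.
elim: n => // n IH; rewrite ltnS leq_eqVlt /= => /orP[/eqP ->|kn].
  by case: ltP => //.
by case: ltP => [/ltW h|_]; [apply: (le_trans h)|]; exact: IH.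
Qed.

Let measurable_selector n :
  measurable_fun (setT : set (measurableTypeR R)) (selector n).
Proof.
have fm := continuous_measurable_prob fc.
elim: n => [|n IH] /=; first exact: measurable_id.
have mq : measurable_fun (setT : set (measurableTypeR R)) (fun x : R => x + q n).
  by apply: measurable_funD; [exact: measurable_id|exact: measurable_cst].
apply: measurable_fun_ifT => //.
by apply: measurable_fun_ltr; exact: measurableT_comp.
Qed.

Let selector_cvg x : f (selector n x) @[n --> \oo] --> running_inf f x.
Proof.
apply/cvgrPdist_lt => e e0.
have [_ [y /= xy <-] fy] := inf_adherent e0 (has_inf_tail x).
(* The near-minimizer [y] is traded for [x + |t|] with [t] rational; the absolute value keeps the
   point in the tail of [x]. *)
have [t /= [t_near [r _ rt]]] :
    [set t : R | f (x + `|t|) < running_inf f x + e] `&` (@ratr R @` setT) !=set0.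
  apply: dense_rat.
    by exists (y - x); rewrite /= ger0_norm ?subr_ge0// addrC subrK.
  rewrite (_ : [set t | _] = (fun t => f (x + `|t|)) @^-1`
    [set z | z < running_inf f x + e])//.
  apply: open_comp; last exact: open_lt.
  move=> t _; apply: continuous_comp; last exact: fc.
  by apply: cvgD; [exact: cvg_cst|exact: norm_continuous].
(* Stage [n] has only compared the shifts of index below [n]. *)
exists (pickle r).+1 => // n /= rn.
have := @selector_min n x _ rn; rewrite /q pickleK /= rt.
have := running_inf_le (selector_ge n x).
rewrite ltr_norml; move: t_near; lra.
Qed.

(** The law of [selector n] under [Q] dominates [Q], hence stays in [A]. A change of variables
    bounds the integral of [f \o selector n] under [Q] from below by [b], and dominated convergence
    passes to the limit. *)
Lemma running_inf_Rintegral_ge (A : set (Prob R)) (b : R) :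
  (forall Q Q', A Q -> sto_le Q Q' -> A Q') ->
  (forall Q, A Q -> b <= \int[Q]_x f x) ->
  forall Q, A Q -> b <= \int[Q]_x running_inf f x.
Proof.
move=> Aup Ab Q AQ.
have fm := continuous_measurable_prob fc.
have rm := continuous_measurable_prob running_inf_continuous.
have step n : b <= \int[Q]_x f (selector n x).
  have mX : @measurable_fun _ _ (measurableTypeR R) (measurableTypeR R) setT
      (selector n).
    by move=> mT Y mY; exact: measurable_selector.
  pose X : {mfun measurableTypeR R >-> measurableTypeR R} := HB.pack
    (selector n : measurableTypeR R -> measurableTypeR R)
    (@isMeasurableFun.Build _ _ (measurableTypeR R) (measurableTypeR R) _ mX).
  have /Aup/(_ _)/Ab := AQ => /(_ (distribution Q X)).
  rewrite /Rintegral integral_distribution//; first apply.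
  - move=> x; rewrite /cdf_of; apply: fine_le; rewrite ?fin_num_measure//.
    rewrite /distribution /pushforward.
    apply: (@le_measure _ _ _ Q _ _ _ _ _); rewrite ?inE//.
      exact: (measurable_funPTI X).
    by move=> y /=; rewrite !in_itv/=; apply: le_trans; exact: selector_ge.
  - exact/measurable_EFinP.
  - apply: (@bounded_prob_integrable _ _ (f \o selector n) M).
      exact: measurableT_comp.
    by move=> x; exact: fM.
have mfs n : measurable_fun (setT : set (measurableTypeR R)) (f \o selector n).
  exact: measurableT_comp.
have [||||| _ _ cvg] := @dominated_convergence _ _ _ Q setT measurableT
    (fun n x => (f (selector n x))%:E) (EFin \o running_inf f) (fun=> M%:E).
- by move=> n; apply/measurable_EFinP; exact: mfs.
- exact/measurable_EFinP.
- by apply: aeW => x _; apply/cvg_EFin; [exact: nearW|exact: selector_cvg].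
- exact: (@bounded_prob_integrable _ Q (fun=> M) `|M|).
- by apply: aeW => x n _; rewrite /= lee_fin.
have fint (g : R -> R) : measurable_fun (setT : set (measurableTypeR R)) g ->
    (forall x, `|g x| <= M) -> (\int[Q]_x (g x)%:E)%E \is a fin_num.
  by move=> mg gM; apply: integrable_fin_num => //;
    exact: bounded_prob_integrable mg gM.
rewrite -lee_fin fineK; last by apply: fint => //; exact: running_inf_bound.
apply: (cvge_ge _ cvg); apply: nearW => n.
rewrite -[leRHS]fineK ?lee_fin ?step//; apply: fint => //.
exact: measurableT_comp.
Qed.

End running_inf.

(** * From nondecreasing functions to continuous cdfs *)

(** Rescaling [h] by its limits at both ends, which differ because [h] is not constant, gives the
    cdf of a Lebesgue-Stieltjes measure. *)
Lemma nondecreasing_bounded_cumulative (R : realType) (h : R -> R) (M : R) :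
  {homo h : x y / x <= y} -> continuous h -> (forall x, `|h x| <= M) ->
  (exists x y, h x != h y) ->
  exists (Q : @Prob_c R) (k c : R), 0 < k /\
    forall x, h x = k * cdf_of (\val Q) x + c.
Proof.
move=> hnd hc hM [x0 [y0 hxy]].
have ubh : has_ubound (range h).
  by exists M => _ [x _ <-]; have := hM x; rewrite ler_norml => /andP[].
(* Reflection turns the limit at [-oo] into one at [+oo]; thus [- a] below is the infimum of [h]. *)
pose h' x := - h (- x).
have hnd' : {homo h' : x y / x <= y} by move=> x y xy; rewrite lerN2 hnd// lerN2.
have ubh' : has_ubound (range h').
  by exists M => _ [x _ <-]; have := hM (- x); rewrite ler_norml /h'; lra.
have hy := nondecreasing_cvgr hnd ubh.
have hNy' := nondecreasing_cvgr hnd' ubh'.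
set b := sup (range h) in hy.
set a := sup (range h') in hNy'.
have hNy : h x @[x --> -oo] --> - a.
  rewrite cvgNy_compNP.
  have -> : h \o -%R = \- h' by apply/funext => x /=; rewrite /h' opprK.
  exact: cvgN.
have hb x : h x <= b by apply: ub_le_sup => //; exists x.
have ha x : - a <= h x.
  by rewrite lerNl; apply: ub_le_sup => //; exists (- x) => //; rewrite /h' opprK.
have ab : 0 < b + a.
  have [xy|xy|xy] := ltgtP (h x0) (h y0); last by rewrite xy eqxx in hxy.
  - by have := ha x0; have := hb y0; lra.
  - by have := ha y0; have := hb x0; lra.
pose F x := (h x + a) / (b + a).
have Fnd : nondecreasing F.
  by move=> x y xy; rewrite ler_pM2r ?invr_gt0// lerD2r hnd.
have Fc : continuous F.
  by move=> x; apply: cvgMl; apply: cvgD; [exact: hc|exact: cvg_cst].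
have Frc : right_continuous F.
  by move=> x; apply: cvg_at_right_filter; exact: Fc.
have FNy : F @ -oo --> (0 : R).
  rewrite -(mul0r (b + a)^-1) -(addNr a).
  by apply: cvgMl; apply: cvgD => //; exact: cvg_cst.
have Fy : F @ +oo --> (1 : R).
  rewrite -(divff (lt0r_neq0 ab)).
  by apply: cvgMl; apply: cvgD => //; exact: cvg_cst.
pose Fcum : cumulativeBounded (0 : R) (1 : R) := HB.pack F
  (isCumulative.Build R _ R F Fnd Frc) (isCumulativeBounded.Build R 0 1 F FNy Fy).
pose Q : Prob R := lebesgue_stieltjes_measure Fcum.
have QF x : cdf_of Q x = F x.
  exact: (congr1 fine (cdf_lebesgue_stieltjes_id Fcum x)).
have cQ : Q \in @Prob_c R.
  by rewrite inE /Prob_c/= (_ : cdf_of Q = F)//; exact/funext.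
exists (exist _ Q cQ), (b + a), (- a); split => // x.
rewrite /= QF /F mulrCA divff ?gt_eqF// mulr1 addrK //.
Qed.

(** * Separation of a law from a convex set of laws *)

(** The vectors [v Q] of integral deviations from [P], for [Q] in [A], form a bounded convex set.
    Missing [V] forces some coordinate to be at least [e] in absolute value. The separating linear
    form supplies the coefficients of [f]. *)
Lemma separating_Cb (R : realType) (A : set (Prob R)) (P : Prob R)
    (V : set (Prob R)) :
  nbhs (P : weak_Prob R) V -> (forall Q, A Q -> ~ V Q) ->
  (forall (l : {i01 R}) Q Q', A Q -> A Q' -> A (mixture l Q Q')) ->
  exists (f : R -> R) (M d : R), [/\ continuous f, forall x, `|f x| <= M,
    0 < d & forall Q, A Q -> \int[P]_x f x + d <= \int[Q]_x f x].
Proof.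
move=> /weak_nbhs_finite[s [e [e0 sV]]] AV Acvx.
have [Mb Mbf] := choice (@Cb_bound R).
have Cbm (f : Cb R) := continuous_measurable_prob (@Cb_continuous _ f).
pose g (i : 'I_(size s)) : Cb R := tnth (in_tuple s) i.
pose v (Q : Prob R) i := \int[Q]_x g i x - \int[P]_x g i x.
have intM (Q : Prob R) (f : Cb R) : `|\int[Q]_x f x| <= Mb f.
  have fint := bounded_prob_integrable Q (Cbm f) (Mbf f).
  have cint (k : R) : Q.-integrable setT (EFin \o cst k).
    by apply: (@bounded_prob_integrable _ Q (cst k) `|k|).
  have cE (k : R) : \int[Q]_x (cst k x) = k.
    by rewrite Rintegral_cst//= probability_setT mulr1.
  rewrite ler_norml; apply/andP; split.
    rewrite -[leLHS]cE; apply: le_Rintegral => // x _.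
    by have := Mbf f x; rewrite ler_norml => /andP[].
  rewrite -[leRHS]cE; apply: le_Rintegral => // x _.
  by have := Mbf f x; rewrite ler_norml => /andP[].
have Mb0 (f : Cb R) : 0 <= Mb f by exact: le_trans (Mbf f 0).
have [||||c [d [d0 cd]]] := @convex_separation R _ (v @` A) e
    (\sum_i (Mb (g i) + Mb (g i))).
- by [].
- move=> _ i [Q _ <-]; rewrite /v (le_trans (ler_normB _ _))//.
  rewrite (le_trans (lerD (intM _ _) (intM _ _)))// (bigD1 i)//= lerDl.
  by rewrite sumr_ge0// => j _; rewrite addr_ge0.
- move=> _ [Q AQ <-]; apply: contrapT => /forallNP h; apply: (AV Q) => //.
  apply: sV => f /(@tnthP _ _ (in_tuple s))[i ->].
  by rewrite ltNge; apply/negP; exact: h.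
- move=> t _ _ t01 [Q AQ <-] [Q' AQ' <-].
  have /andP[t0 t1] := t01; pose l := Itv01 t0 t1.
  exists (mixture l Q Q'); first exact: Acvx.
  apply/funext => i.
  rewrite /v (mixture_Rintegral l Q Q' (Cbm (g i)) (Mbf (g i)))/=; ring.
exists (fun x => \sum_i c i * g i x), (\sum_i `|c i| * Mb (g i)), d.
have gm i : measurable_fun (setT : set (measurableTypeR R)) (fun x => c i * g i x).
  by apply: measurable_funM; [exact: measurable_cst|exact: Cbm].
have gM i x : `|c i * g i x| <= `|c i| * Mb (g i).
  by rewrite normrM ler_wpM2l.
have gE (Q : Prob R) :
    \int[Q]_x (\sum_i c i * g i x) = \sum_i c i * \int[Q]_x g i x.
  rewrite (Rintegral_sum_prob Q _ gm gM); apply: eq_bigr => i _.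
  by rewrite RintegralZl//; exact: (bounded_prob_integrable Q (Cbm _) (Mbf _)).
split => //.
- apply: continuous_big => [|i _ x]; first exact: add_continuous.
  by apply: cvgMr; exact: Cb_continuous.
- by move=> x; rewrite (le_trans (ler_norm_sum _ _ _))// ler_sum.
- move=> Q AQ; rewrite !gE -lerBrDl -sumrB.
  have := cd _ (imageP v AQ); rewrite /v.
  by under eq_bigr do rewrite mulrBr.
Qed.

Lemma cdf_of_integrable (R : realType) (P : Prob R) (F : @Prob_c R) :
  P.-integrable setT (EFin \o cdf_of (\val F)).
Proof.
have [M FM] := Cb_bound (opp_cdf F).
apply: (@bounded_prob_integrable _ P _ M).
  exact: continuous_measurable_prob (set_valP F).
by move=> x; rewrite -normrN; exact: FM.
Qed.

Lemma separating_cdf (R : realType) (A : set (Prob R)) (P : Prob R)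
    (V : set (Prob R)) :
  nbhs (P : weak_Prob R) V -> (forall Q, A Q -> ~ V Q) ->
  (forall (l : {i01 R}) Q Q', A Q -> A Q' -> A (mixture l Q Q')) ->
  (forall Q Q', A Q -> sto_le Q Q' -> A Q') ->
  exists F : @Prob_c R, forall Q, A Q ->
    \int[P]_x cdf_of (\val F) x < \int[Q]_x cdf_of (\val F) x.
Proof.
move=> nV AV Acvx Aup.
(* For empty [A] any continuous cdf works; a rescaled [atan] provides one. *)
have [[Q0 AQ0]|A0] := pselect (A !=set0); last first.
  have [x y|x|x||F _] := @nondecreasing_bounded_cumulative R atan (pi / 2).
  - exact: le_atan.
  - exact: continuous_atan.
  - by rewrite ler_norml !ltW ?atan_ltpi2 ?atan_gtNpi2.
  - by exists 0, 1; rewrite lt_eqF// lt_atan.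
  by exists F => Q AQ; case: A0; exists Q.
have [f [M [d [fc fM d0 fA]]]] := separating_Cb nV AV Acvx.
pose h := running_inf f.
have hc : continuous h := running_inf_continuous fM fc.
have hM : forall x, `|h x| <= M := running_inf_bound fM.
have hint (S : Prob R) : S.-integrable setT (EFin \o h) :=
  bounded_prob_integrable S (continuous_measurable_prob hc) hM.
have hA Q : A Q -> \int[P]_x h x < \int[Q]_x h x.
  move=> AQ; have := running_inf_Rintegral_ge fM fc Aup fA AQ.
  apply: lt_le_trans; apply: (@le_lt_trans _ _ (\int[P]_x f x)).
    apply: le_Rintegral => //; first exact: hint.
      exact: (bounded_prob_integrable P (continuous_measurable_prob fc) fM).
    by move=> x _; exact: (running_inf_le fM).
  by rewrite ltrDl.
(* A constant [h] would have equal integrals under [P] and [Q0], against the strict inequality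
   [hA]. *)
have hne : exists x y, h x != h y.
  apply: contrapT => hcst.
  have hE x : h x = cst (h 0) x.
    by apply: contrapT => /eqP h0; apply: hcst; exists x, 0.
  have := hA _ AQ0; rewrite (_ : h = cst (h 0)); last exact/funext.
  by rewrite !Rintegral_cst//= !probability_setT ltxx.
have [F [k [c [k0 hF]]]] := nondecreasing_bounded_cumulative
  (running_inf_nondecreasing fM) hc hM hne.
exists F => Q /hA.
have hE (S : Prob R) : \int[S]_x h x = k * (\int[S]_x cdf_of (\val F) x) + c.
  rewrite (_ : h = fun x => k * cdf_of (\val F) x + cst c x); last exact/funext.
  rewrite RintegralD//; last 2 first.
  - exact: (integrableZl measurableT k (cdf_of_integrable S F)).
  - by apply: (@bounded_prob_integrable _ S (cst c) `|c|).
  rewrite RintegralZl//; last exact: cdf_of_integrable.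
  by rewrite Rintegral_cst//= probability_setT mulr1.
by rewrite !hE ltrD2r ltr_pM2l.
Qed.

(** * The dual representation *)

Theorem proposition25 (R : realType) (Phi : Prob R -> \bar R)
    (Phi_risk : risk_measure Phi)
    (Phi_lsc : lower_semicontinuous (Phi : weak_Prob R -> \bar R))
    (P : Prob R) :
  Phi P = ereal_sup
    [set dual_fun Phi (- (\int[P]_x cdf_of (\val Q) x)%R) (opp_cdf Q)
      | Q in [set: @Prob_c R]].
Proof.
have [_ Phi_mono Phi_qc] := Phi_risk.
have intN (S : Prob R) (F : @Prob_c R) :
    \int[S]_x opp_cdf F x = - \int[S]_x cdf_of (\val F) x.
  rewrite -mulN1r -RintegralZl//; last exact: cdf_of_integrable.
  by apply: eq_Rintegral => x _; rewrite mulN1r.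
apply/eqP; rewrite eq_le; apply/andP; split; last first.
  (* [P] itself is admissible in each infimum. *)
  apply: ge_ereal_sup => _ [F _ <-].
  by apply: ereal_inf_lbound; exists P => //=; rewrite intN.
set S := ereal_sup _.
have below (a : R) : (a%:E < Phi P)%E -> (a%:E <= S)%E.
  (* Lower semicontinuity gives a weak neighbourhood [V] of [P] on which [Phi] exceeds [a], so the
     sublevel set of [a] misses it. *)
  move=> aP; have [V PV aV] := Phi_lsc _ _ aP.
  have [|||F hF] := @separating_cdf R [set Q : Prob R | (Phi Q <= a%:E)%E] P V PV.
  - by move=> Q /= Qa /aV; rewrite ltNge Qa.
  - move=> l Q Q' /= Qa Qa'; apply: (le_trans (Phi_qc l Q Q')).
    by rewrite ge_max Qa.
  - by move=> Q Q' /= Qa /Phi_mono; move/le_trans; apply.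
  apply: le_ereal_sup_tmp; eexists; first by exists F.
  apply: le_ereal_inf_tmp => _ [Q FQ <-].
  (* The constraint of the infimum, once signs are cleared, is the reverse of the strict inequality
     [hF]; so an admissible [Q] lies outside the sublevel set. *)
  have FQP : \int[Q]_x cdf_of (\val F) x <= \int[P]_x cdf_of (\val F) x.
    by rewrite -lerN2 -(intN Q).
  by rewrite leNgt; apply/negP => /ltW /hF; rewrite ltNge FQP.
have PhiNy : (Phi P != -oo)%E by case: Phi_risk.
(* The bound [below] concerns reals strictly under [Phi P]: a finite value is approached by [r - e],
   an infinite one through all reals. *)
case: (Phi P) PhiNy below => [r _ below|_ below|//].
  apply/lee_subgt0Pr => e e0; rewrite -EFinB; apply: below.
  by rewrite lte_fin ltrBlDr ltrDl.
by rewrite leye_eq; apply/eqP/eqyP => A _; apply: below; rewrite ltry.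
Qed.
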